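(* Let $n\in\mathbb{N}$ be even with $n\ge 4$. Let $x=(x_1,\dots,x_n)$ be distributed uniformly on $$\Omega_n:=\Bigl\{x\in\{-1,1\}^n:\sum_{i=1}^n x_i=0\Bigr\},$$ and put $c_n=\sqrt{\frac{n-2}{2(n-1)}}$. Then for every $a=(a_1,\dots,a_n)\in\mathbb{R}^n$, $$c_n\sqrt{\mathbb{E}\Big|\sum_{i=1}^n a_ix_i\Big|^2}\ \le\ \mathbb{E}\Big|\sum_{i=1}^n a_ix_i\Big|.$$ Moreover, $c_n$ is optimal, i.e. it is the largest constant for which this inequality holds for all $a\in\mathbb{R}^n$. *)

(* Defs.v *)
From mathcomp Require Import all_boot all_order all_algebra.
From mathcomp Require Import all_classical all_reals all_analysis.

Set Implicit Arguments.
Unset Strict Implicit.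
Unset Printing Implicit Defensive.

Import Order.TTheory GRing.Theory Num.Theory.

Local Open Scope ring_scope.

(* A point of {-1,1}^n is encoded by the exponents e of its coordinates
   (-1) ^+ e i, so [true] stands for -1 and [false] for 1. *)
Definition Omega (n : nat) : {set {ffun 'I_n -> bool}} :=
  [set e : {ffun 'I_n -> bool} | \sum_(i < n) (-1) ^+ e i == 0 :> int].

(* The common mass 1/#|Omega n| of the points of Omega n, when added up over
   Omega n, is 1; so this determines the joint law of x_1, ..., x_n. *)
Definition uniform_on_Omega (R : realType) (n : nat) (d : measure_display)
    (T : measurableType d) (P : probability T R)
    (x : 'I_n -> {RV P >-> R}) : Prop :=
  forall e : {ffun 'I_n -> bool}, e \in Omega n ->
    P [set w : T | forall i : 'I_n, x i w = (-1) ^+ e i]%classic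
    = (#|Omega n|%:R^-1)%:E.

Definition c_ (R : realType) (n : nat) : R :=
  Num.sqrt ((n%:R - 2) / (2 * (n%:R - 1))).

(* Main.v *)
Require Import Defs.
From mathcomp Require Import all_boot all_order all_algebra perm.
From mathcomp Require Import all_classical all_reals all_analysis measurable_realfun.
From mathcomp Require Import ring lra zify.

(** Write n = 2m and encode x by the m-element set A of the coordinates equal
    to -1, so that x is uniform on the middle layer of the Boolean lattice of
    subsets of 'I_n; put S(A) = sign_sum a A.

    The inequality is a spectral gap argument applied to F = |S|, in the
    manner of Latala and Oleszkiewicz. Let L be the generator of the walk that
    exchanges an element of A with one of its complement, summed over the m^2
    possible exchanges. It acts on functions of degree k with eigenvalue
    k(n - k + 1).
    - S has mean 0 and degree 1, so L S = n S, that is, the exchanges of A add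
      up to (m^2 - n) S(A), with m^2 >= n; by the triangle inequality L F <= n F pointwise, whence <F, L F> <= n |F|^2.
    - F is invariant under A |-> ~: A, so it has no part of degree 1, and on its
      centred part L is at least its eigenvalue 2(n - 1) for degree 2:
      2(n - 1) Var F <= E (F * L F).
    Together these give 2(n - 1) (E F^2 - (E F)^2) <= n E F^2, which is
    (n - 2) E F^2 <= 2(n - 1) (E F)^2, the square of the inequality to prove.

    The gap is obtained without decomposing functions by degree. The operators
    up and down between neighbouring layers are adjoint to each other, and
    on each layer up \o down and down \o up equal the sum over exchanges plus a
    multiple of the identity (up_down, down_up). So a bound for
    down on one layer passes to the next layer (down_norm_le), starting from
    the fact that a function on singletons orthogonal to every
    [fun A => i \in A] is 0. khinchin_layer combines the two estimates.

    The constant is attained by a = e_i + e_j with i != j: then |S| only takes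
    the values 0 and 2, so S^2 = 2|S|, and
    E|S| = 1 + E x_i x_j = (n - 2) / (n - 1) because, by symmetry,
    E x_i x_j = - 1 / (n - 1) (sign_cov_layer). *)

Set Implicit Arguments.
Unset Strict Implicit.
Unset Printing Implicit Defensive.

Import Order.TTheory GRing.Theory Num.Theory.
Local Open Scope ring_scope.

(** * The Boolean lattice and its up and down operators *)

Section BooleanLattice.
Variables (R : realFieldType) (T : finType).
Implicit Types (f g : {set T} -> R) (A B : {set T}) (i j : T).

Definition dot f g : R := \sum_A f A * g A.
Definition up f A : R := \sum_(i in A) f (A :\ i).
Definition down f B : R := \sum_(i | i \notin B) f (i |: B).

Lemma dot_ge0 f : 0 <= dot f f.
Proof. by apply: sumr_ge0 => A _; rewrite -expr2 sqr_ge0. Qed.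

Lemma dotC f g : dot f g = dot g f.
Proof. by apply: eq_bigr => A _; rewrite mulrC. Qed.

Lemma sum_setU1 i (h : {set T} -> R) :
  \sum_(A : {set T} | i \in A) h A = \sum_(B : {set T} | i \notin B) h (i |: B).
Proof.
rewrite (reindex_onto (fun B : {set T} => i |: B)
  (fun A : {set T} => A :\ i)) /=; last first.
  by move=> A iA; rewrite finset.setD1K.
apply: eq_bigl => B; rewrite finset.setU11 /=; apply/eqP/idP => [<-|iB].
  by rewrite !inE eqxx.
by rewrite finset.setU1K.
Qed.

Lemma dot_up g f : dot (up g) f = dot g (down f).
Proof.
rewrite /dot /up /down.
under eq_bigr do rewrite big_distrl /=.
under [RHS]eq_bigr do rewrite big_distrr /=.
rewrite (exchange_big_dep xpredT) //= [RHS](exchange_big_dep xpredT) //=.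
apply: eq_bigr => i _; rewrite sum_setU1.
by apply: eq_bigr => B iB; rewrite finset.setU1K.
Qed.

(** The sum over the neighbours of A in the exchange walk on its layer. *)
Definition swaps f A : R :=
  \sum_(j in A) \sum_(i | i \notin A) f (i |: (A :\ j)).

Lemma up_down f A : up (down f) A = #|A|%:R * f A + swaps f A.
Proof.
rewrite /up /down /swaps mulr_natl -sumr_const -big_split /=.
apply: eq_bigr => j jA.
rewrite (bigD1 j) ?finset.setD11 //= finset.setD1K //; congr (_ + _).
apply: eq_bigl => i; rewrite !inE negb_and negbK.
by case: eqVneq => [->|]; rewrite ?jA ?andbT.
Qed.

(** Going up and then down yields the same exchanges as going down and then up;
    only the number of ways to come back to A differs. This is the sl2
    commutation relation that drives the induction in down_norm_le. *)
Lemma down_up f A : down (up f) A = #|~: A|%:R * f A + swaps f A.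
Proof.
rewrite /up /down /swaps exchange_big mulr_natl -sumr_const /=.
rewrite [X in X + _](eq_bigl (fun i => i \notin A)); last by move=> i; rewrite inE.
rewrite -big_split /=.
apply: eq_bigr => i iA; rewrite big_setU1 //= finset.setU1K //; congr (_ + _).
apply: eq_bigr => j jA; congr f; apply/setP => k; rewrite !inE.
case: (eqVneq k i) => [->|_] //=; rewrite ?andbT ?andbF //.
by apply: contraNneq iA => ->.
Qed.

(** * The gap above degree one *)

(** The functions on layer k that are orthogonal to all functions of degree at
    most 1. For k > 0 orthogonality to the constants is implied: summing the
    second condition over i gives k times the total sum of f. *)
Definition orth_linear k f :=
  (forall A, #|A| != k -> f A = 0) /\
  (forall i, \sum_(A : {set T} | i \in A) f A = 0).

(** A set A containing i covers exactly #|A| - 1 = k sets that contain i. *)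
Lemma orth_linear_down k f : orth_linear k.+1 f -> orth_linear k (down f).
Proof.
move=> [f_supp f_lvl]; split=> [B Bk|i].
  by apply: big1 => i iB; apply: f_supp; rewrite cardsU1 iB.
rewrite /down.
have -> : \sum_(B : {set T} | i \in B) \sum_(j | j \notin B) f (j |: B)
        = k%:R * \sum_(A : {set T} | i \in A) f A; last by rewrite f_lvl mulr0.
rewrite (exchange_big_dep xpredT) //= mulr_sumr.
transitivity (\sum_j \sum_(A : {set T} | (j \in A) && (i \in A :\ j)) f A).
  apply: eq_bigr => j _; rewrite big_mkcondl [RHS]big_mkcondr sum_setU1 /=.
  by apply: eq_bigr => B jB; rewrite finset.setU1K.
rewrite (exchange_big_dep (fun A => i \in A)) /=; last first.
  by move=> j A _ /andP[_]; rewrite !inE => /andP[].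
apply: eq_bigr => A iA; rewrite sumr_const.
have [Ak|/f_supp->] := eqVneq #|A| k.+1; last by rewrite mul0rn mulr0.
rewrite mulr_natl; congr (_ *+ _).
have -> : #|[pred j | (j \in A) && (i \in A :\ j)]| = #|A :\ i|.
  by apply: eq_card => j; rewrite !inE iA andbT andbC eq_sym.
by move: (cardsD1 i A); rewrite iA Ak add1n => -[->].
Qed.

Lemma orth_linear1 f A : orth_linear 1 f -> f A = 0.
Proof.
move=> [f_supp f_lvl].
have [/eqP/cards1P[i ->]|/f_supp//] := eqVneq #|A| 1%N.
rewrite -[RHS](f_lvl i) (bigD1 [set i]) ?finset.set11 //= big1 ?addr0 // => B.
have [/eqP/cards1P[j ->]|/f_supp->//] := eqVneq #|B| 1%N.
by rewrite inE => /andP[/eqP->]; rewrite eqxx.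
Qed.

(** The constant is k (n - k + 1) - 2 (n - 1), where n = #|T|: the value of
    up \o down on constants minus the eigenvalue 2 (n - 1) of the exchange walk
    in degree 2. It vanishes for k = 2 and increases by n - 2 k from layer k to
    layer k + 1, which is the multiple of the identity by which down \o up and
    up \o down differ on layer k. With g = down f this bounds |up g|^2 by c |g|^2,
    and a bound for up gives the same bound for its adjoint down. *)
Lemma down_norm_le k f : (2 <= k)%N -> (k.*2 <= #|T|)%N -> orth_linear k f ->
  dot (down f) (down f) <= (k%:R - 2) * (#|T|%:R - k%:R - 1) * dot f f.
Proof.
elim: k f => // -[|[|k]] IHk f // _ k2n f_orth.
  (* On layer 2 the constant is 0, and down f lives on singletons. *)
  rewrite subrr !mul0r /dot big1 // => A _.
  by rewrite orth_linear1 ?mul0r //; apply: orth_linear_down.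
set g := down f; set c := (X in _ <= X * dot f f).
have [g_supp g_lvl] : orth_linear k.+2 g by apply: orth_linear_down.
have k2E : k.+2%:R = k%:R + 2 :> R by rewrite -addn2 natrD.
have k3E : k.+3%:R = k%:R + 3 :> R by rewrite -addn3 natrD.
have k_ge0 : 0 <= k%:R :> R by [].
have k2n' : k%:R + k%:R + 6 <= #|T|%:R :> R.
  by rewrite -!natrD ler_nat (leq_trans _ k2n) // -addnn !addSn !addnS addn0.
have c_gt0 : 0 < c by rewrite /c k3E; apply: mulr_gt0; lra.
have up_g_le : dot (up g) (up g) <= c * dot g g.
  have comm B : g B * down (up g) B
      = (#|T|%:R - 2 * k.+2%:R) * (g B * g B) + g B * up (down g) B.
    have [Bk|/g_supp->] := eqVneq #|B| k.+2; last by rewrite !mul0r mulr0 addr0.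
    rewrite down_up up_down Bk -(cardsC B) Bk natrD k2E; ring.
  rewrite dot_up {1}/dot (eq_bigr _ (fun B _ => comm B)) big_split /= -mulr_sumr.
  rewrite -/(dot g g) -/(dot g (up (down g))) [dot g (up _)]dotC dot_up.
  have := IHk g isT (leq_trans (leqW (leqnSn _)) k2n) (conj g_supp g_lvl).
  rewrite /c k2E k3E; lra.
have fg : dot (up g) f = dot g g by rewrite dot_up.
(* As <f, up g> = |g|^2, expanding 0 <= |c f - up g|^2 leaves
   0 <= c (c |f|^2 - |g|^2). *)
have := dot_ge0 (fun A => c * f A - up g A).
have -> : dot (fun A => c * f A - up g A) (fun A => c * f A - up g A) =
   c ^+ 2 * dot f f - 2 * c * dot (up g) f + dot (up g) (up g).
  rewrite /dot !mulr_sumr -sumrB -big_split /=.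
  by apply: eq_bigr => A _; ring.
rewrite fg => h; rewrite -(ler_pM2l c_gt0); nra.
Qed.

(** A function invariant under complement has the same sum over the sets that
    contain i as over those that do not, and these two sums cancel. *)
Lemma orth_linear_even m f : #|T| = m.*2 ->
    (forall A, #|A| != m -> f A = 0) -> (forall A, f (~: A) = f A) ->
  \sum_A f A = 0 -> orth_linear m f.
Proof.
move=> Tm f_supp f_even f_sum; split=> // i.
have f_half : \sum_(A : {set T} | i \in A) f A
            = \sum_(A : {set T} | i \notin A) f A.
  rewrite (reindex_inj (inv_inj (@finset.setCK T))) /=.
  by apply: eq_big => A; rewrite ?inE.
move: f_sum; rewrite (bigID (fun A : {set T} => i \in A)) /= -f_half; lra.
Qed.

Lemma up_down_layer m f A : (forall B, #|B| = m -> f B = 1) ->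
  #|A| = m -> up (down f) A = m%:R * (1 + #|~: A|%:R).
Proof.
move=> f1 Am; rewrite up_down Am f1 // mulrDr; congr (_ + _).
rewrite /swaps (eq_bigr (fun=> #|~: A|%:R)) => [|j jA].
  by rewrite sumr_const Am mulr_natl.
rewrite (eq_bigr (fun=> 1)) => [|i iA].
  by rewrite sumr_const; congr (_ *+ _); apply: eq_card => i; rewrite !inE.
by rewrite f1 // cardsU1 !inE (negbTE iA) andbF -Am (cardsD1 j A) jA.
Qed.

(** * Khinchin's inequality on the middle layer *)

Definition sign_sum (a : T -> R) A : R := \sum_i a i * (-1) ^+ (i \in A).

Lemma sign_sumE a A :
  sign_sum a A = \sum_i a i - 2 * \sum_(i in A) a i.
Proof.
rewrite /sign_sum mulr_sumr [X in _ - X]big_mkcond -sumrB.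
by apply: eq_bigr => i _; case: (i \in A); rewrite ?expr1 ?expr0; ring.
Qed.

Lemma sign_sumC a A : sign_sum a (~: A) = - sign_sum a A.
Proof.
rewrite -sumrN; apply: eq_bigr => i _; rewrite inE.
by case: (i \in A); rewrite ?expr1 ?expr0; ring.
Qed.

(** On the middle layer sign_sum a is an eigenfunction of the exchange walk: of
    the m^2 exchanges, each element takes part in m, and moving i across
    changes the sum by 2 a_i. *)
Lemma swaps_sign_sum m a A : #|A| = m -> #|T| = m.*2 ->
  swaps (sign_sum a) A = (m%:R ^+ 2 - 2 * m%:R) * sign_sum a A.
Proof.
move=> Am Tm; have ACm : #|~: A| = m by have := cardsC A; lia.
have sum_notin (c : R) : \sum_(i | i \notin A) c = m%:R * c.
  rewrite sumr_const -ACm mulr_natl; congr (_ *+ _).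
  by apply: eq_card => i; rewrite !inE.
have -> : swaps (sign_sum a) A =
    \sum_(j in A) \sum_(i | i \notin A) (sign_sum a A + 2 * a j - 2 * a i).
  apply: eq_bigr => j jA; apply: eq_bigr => i iA.
  rewrite !sign_sumE big_setU1 ?(big_setD1 j jA) //=; first by ring.
  by rewrite !inE negb_and iA orbT.
under eq_bigr => j jA do rewrite sumrB -mulr_sumr sum_notin.
rewrite sumrB -mulr_sumr big_split /= -mulr_sumr !sumr_const Am.
have := sign_sumE a A; rewrite (bigID (mem A)) /=.
rewrite -(mulr_natr (sign_sum a A)) -(mulr_natr (2 * _)).
move: (sign_sum a A) (\sum_(i in A) a i) (\sum_(i | i \notin A) a i) => x y z ->.
ring.
Qed.

Definition layer m := [set A : {set T} | #|A| == m].

(** The gap 2 (n - 1) for the centred part of |sign_sum a|, against the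
    pointwise bound that the triangle inequality draws from swaps_sign_sum. *)
Lemma khinchin_layer m a : (2 <= m)%N -> #|T| = m.*2 ->
  (#|T|%:R - 2) * (#|layer m|%:R * \sum_(A in layer m) `|sign_sum a A| ^+ 2)
    <= 2 * (#|T|%:R - 1) * (\sum_(A in layer m) `|sign_sum a A|) ^+ 2.
Proof.
move=> m_ge2 Tm; set N : R := #|layer m|%:R; set s : R := \sum_(A in _) `|_|.
have cardCm A : (#|~: A| == m) = (#|A| == m) by have := cardsC A; lia.
have TmR : #|T|%:R = 2 * m%:R :> R by rewrite Tm -mul2n natrM.
have mR_ge2 : 2 <= m%:R :> R by rewrite ler_nat.
pose one A : R := (#|A| == m)%:R.
pose F A : R := (#|A| == m)%:R * `|sign_sum a A|.
(* The centring of F, scaled by N to avoid a division. *)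
pose f A : R := N * F A - s * one A.
have oneC A : one (~: A) = one A by rewrite /one cardCm.
have FC A : F (~: A) = F A by rewrite /F cardCm sign_sumC normrN.
have sumF : \sum_A F A = s.
  rewrite /s [RHS]big_mkcond; apply: eq_bigr => A _; rewrite /F inE.
  by case: eqP; rewrite ?mul1r ?mul0r.
clearbody s.
have sum1 : \sum_A one A = N.
  rewrite /N -sum1_card natr_sum [RHS]big_mkcond; apply: eq_bigr => A _.
  by rewrite /one inE; case: eqP.
have sumF2 : dot F F = \sum_(A in layer m) `|sign_sum a A| ^+ 2.
  rewrite /dot [RHS]big_mkcond; apply: eq_bigr => A _; rewrite /F inE.
  by case: eqP; rewrite ?mul1r ?mul0r // expr2.
have dot1 (h : {set T} -> R) : (forall A, #|A| != m -> h A = 0) ->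
    dot one h = \sum_A h A.
  move=> h0; apply: eq_bigr => A _; rewrite /one.
  by case: (eqVneq #|A| m) => [_|/h0->]; rewrite ?mul1r ?mulr0.
have F0 A : #|A| != m -> F A = 0 by rewrite /F => /negbTE->; rewrite mul0r.
have one0 A : #|A| != m -> one A = 0 by rewrite /one => /negbTE->.
have f_orth : orth_linear m f.
  apply: orth_linear_even => // [A Am|A|].
  - by rewrite /f F0 // one0 // !mulr0 subrr.
  - by rewrite /f FC oneC.
  - by rewrite sumrB -!mulr_sumr sumF sum1; ring.
(* up \o down is the constant m + m^2 on the indicator of the layer. *)
have D1 (h : {set T} -> R) : (forall A, #|A| != m -> h A = 0) ->
    dot (down one) (down h) = m%:R * (1 + m%:R) * \sum_A h A.
  move=> h0; rewrite -dot_up /dot mulr_sumr; apply: eq_bigr => A _.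
  have [Am|/h0->] := eqVneq #|A| m; last by rewrite !mulr0.
  rewrite (@up_down_layer m) // => [|B Bm]; last by rewrite /one Bm eqxx.
  by have /eqP-> : #|~: A| == m by rewrite cardCm Am.
have bilin (L : ({set T} -> R) -> {set T} -> R) :
    (forall A, L f A = N * L F A - s * L one A) ->
  dot (L f) (L f) = N ^+ 2 * dot (L F) (L F)
    - 2 * N * s * dot (L one) (L F) + s ^+ 2 * dot (L one) (L one).
  move=> LE; rewrite /dot !mulr_sumr -sumrB -big_split /=.
  by apply: eq_bigr => A _; rewrite LE; ring.
(* Expand the gap inequality for f in terms of F and the indicator. *)
have := @down_norm_le m f m_ge2; rewrite Tm => /(_ (leqnn _) f_orth).
rewrite -Tm TmR (bilin down) => [|A]; last first.
  by rewrite /down sumrB -!mulr_sumr.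
rewrite (bilin id) // /id !D1 // !dot1 // sumF sum1.
(* Each exchange sum of F is at least the absolute value of that of
   sign_sum a, by the triangle inequality. *)
have low : (m%:R ^+ 2 - m%:R) * dot F F <= dot (down F) (down F).
  rewrite -dot_up /dot mulr_sumr; apply: ler_sum => A _.
  have [Am|/F0->] := eqVneq #|A| m; last by rewrite !mulr0.
  rewrite mulrA ler_wpM2r ?mulr_ge0 // up_down Am.
  have : (m%:R ^+ 2 - 2 * m%:R) * F A <= swaps F A; last by lra.
  rewrite /F Am eqxx mul1r -[X in X * _]ger0_norm; last by nra.
  rewrite -normrM -(swaps_sign_sum a Am Tm) /swaps.
  apply: le_trans (ler_norm_sum _ _ _) _; apply: ler_sum => j jA.
  apply: le_trans (ler_norm_sum _ _ _) _; apply: ler_sum => i iA.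
  by rewrite cardsU1 !inE (negbTE iA) andbF -Am (cardsD1 j A) jA eqxx mul1r.
rewrite -sumF2; move: low.
have : 0 <= N by [].
rewrite le_eqVlt => /orP[/eqP <- _ _|N_gt0 low up].
  by rewrite mul0r mulr0 mulr_ge0 ?sqr_ge0 //; lra.
rewrite -(ler_pM2l N_gt0).
have := ler_wpM2l (sqr_ge0 N) low.
lra.
Qed.

(** * Covariance of two coordinates and the extremal vector *)

Lemma sum_sign_layer m A : #|T| = m.*2 -> A \in layer m ->
  \sum_i (-1) ^+ (i \in A) = 0 :> R.
Proof.
move=> Tm; rewrite inE => /eqP Am.
have := sign_sumE (fun=> 1) A; rewrite /sign_sum.
under eq_bigr do rewrite mul1r.
by move=> ->; rewrite !sumr_const Am Tm -mul2n natrM subrr.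
Qed.

(** All pairs of distinct coordinates have the same covariance, because
    transpositions preserve the layer; fixing i, the covariances with all
    coordinates, itself included, add up to 0. *)
Lemma sign_cov_layer m i j : #|T| = m.*2 -> i != j ->
  (#|T|%:R - 1) * \sum_(A in layer m) (-1) ^+ (i \in A) * (-1) ^+ (j \in A)
    = - #|layer m|%:R :> R.
Proof.
move=> Tm ij; set t := \sum_(A in _) _.
have tE k : i != k ->
    \sum_(A in layer m) (-1) ^+ (i \in A) * (-1) ^+ (k \in A) = t.
  move=> ik; rewrite /t.
  rewrite [RHS](reindex_inj (imset_inj (@perm_inj _ (tperm j k)))) /=.
  have memJ l A : (l \in tperm j k @: A) = (tperm j k l \in A).
    by rewrite -{1}(tpermK j k l) mem_imset //; apply: perm_inj.
  apply: eq_big => A; first by rewrite !inE card_imset //; apply: perm_inj.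
  by move=> _; rewrite !memJ tpermL tpermD 1?eq_sym.
have : \sum_(A in layer m) (-1) ^+ (i \in A) * (\sum_k (-1) ^+ (k \in A)) = 0 :> R.
  by rewrite big1 // => A /sum_sign_layer->; rewrite ?mulr0.
under eq_bigr do rewrite mulr_sumr.
rewrite exchange_big (bigD1 i) //=.
rewrite (eq_bigr (fun=> 1)) => [|A _]; last by rewrite -expr2 sqrr_sign.
rewrite sumr_const (eq_bigr (fun=> t)) => [|k ki]; last by rewrite tE // eq_sym.
rewrite sumr_const cardC1 => e.
have T_gt0 : (0 < #|T|)%N by apply/card_gt0P; exists i.
rewrite -[#|T|]prednK // -natr1 addrK mulr_natl; lra.
Qed.

Lemma sign_sum_pair i j A :
  sign_sum (fun k => (k == i)%:R + (k == j)%:R) A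
    = (-1) ^+ (i \in A) + (-1) ^+ (j \in A).
Proof.
rewrite /sign_sum; under eq_bigr do rewrite mulrDl.
rewrite big_split /=; congr (_ + _).
  rewrite (bigD1 i) //= eqxx mul1r big1 ?addr0 // => k /negbTE->.
  by rewrite mul0r.
rewrite (bigD1 j) //= eqxx mul1r big1 ?addr0 // => k /negbTE->.
by rewrite mul0r.
Qed.

Lemma norm_add_sign (b c : bool) :
  `|(-1) ^+ b + (-1) ^+ c| = 1 + (-1) ^+ b * (-1) ^+ c :> R.
Proof.
case: b; case: c; rewrite ?expr0 ?expr1.
- by rewrite -opprD normrN ger0_norm; lra.
- by rewrite addNr normr0; lra.
- by rewrite subrr normr0; lra.
- by rewrite ger0_norm; lra.
Qed.

Lemma sqr_norm_add_sign (b c : bool) :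
  `|(-1) ^+ b + (-1) ^+ c| ^+ 2 = 2 * `|(-1) ^+ b + (-1) ^+ c| :> R.
Proof.
rewrite norm_add_sign.
by case: b; case: c; rewrite ?expr0 ?expr1; ring.
Qed.

End BooleanLattice.

(** * From expectations to sums over the middle layer *)

(** The events E i with i in s have total probability 1, so their union has a
    null complement and X may be integrated over each E i, where it is constant. *)
Lemma expectation_finite_cover (R : realType) (d : measure_display)
    (T : measurableType d) (P : probability T R) (I : choiceType) (s : seq I)
    (E : I -> set T) (X : T -> R) (v : I -> R) :
    uniq s -> (forall i, measurable (E i)) -> trivIset setT E ->
    (\sum_(i <- s) P (E i) = 1)%E ->
    measurable_fun setT X -> (forall w, 0 <= X w) ->
    (forall i w, i \in s -> E i w -> X w = v i) ->
  ('E_P[X] = \sum_(i <- s) (v i)%:E * P (E i))%E.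
Proof.
move=> us mE tE PE1 mX X0 Xv; rewrite unlock.
have mEU : measurable (\big[setU/set0]_(i <- s) E i) by exact: bigsetU_measurable.
have PEU : P (\big[setU/set0]_(i <- s) E i) = 1%E.
  rewrite -PE1 -bigcup_seq measure_fin_bigcup //.
  - by rewrite -fsbig_seq.
  - exact: sub_trivIset tE.
have /measurable_EFinP mX' := mX.
rewrite (ge0_negligible_integral (measurableC mEU)) //=; last 2 first.
- by move=> w _; rewrite lee_fin.
- by rewrite probability_setC// PEU subee.
rewrite setTD setCK ge0_integral_bigsetU //=.
- rewrite big_seq [RHS]big_seq; apply: eq_bigr => i si.
  rewrite (eq_integral (cst (v i)%:E)) ?integral_cst//.
  by move=> w; rewrite inE => /(Xv i w si) ->.
- exact: sub_trivIset tE.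
- exact: measurable_funTS.
- by move=> w _; rewrite lee_fin.
Qed.

Lemma expectation_uniform_on_Omega (R : realType) (n : nat)
    (d : measure_display) (T : measurableType d) (P : probability T R)
    (x : 'I_n -> {RV P >-> R}) (X : T -> R) (v : {ffun 'I_n -> bool} -> R) :
    uniform_on_Omega x -> (0 < #|Omega n|)%N ->
    measurable_fun setT X -> (forall w, 0 <= X w) ->
    (forall (e : {ffun 'I_n -> bool}) w,
      (forall i, x i w = (-1) ^+ e i) -> X w = v e) ->
  fine 'E_P[X] = (\sum_(e in Omega n) v e) / #|Omega n|%:R.
Proof.
move=> x_unif N_gt0 mX X0 Xv.
pose E (e : {ffun 'I_n -> bool}) :=
  [set w | forall i, x i w = (-1) ^+ e i]%classic.
have mE e : measurable (E e).
  have -> : E e =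
      (\bigcap_(i in [set: 'I_n]) (x i @^-1` [set (-1) ^+ e i]))%classic.
    by apply/seteqP; split=> w /= h i; [move=> _|]; exact: h.
  exact: fin_bigcap_measurable.
have tE : trivIset setT E.
  move=> e e' _ _ [w [/= we we']]; apply/ffunP => i.
  by apply: (@signr_inj R); rewrite -we -we'.
have PE e : e \in enum (Omega n) -> P (E e) = (#|Omega n|%:R^-1)%:E.
  by rewrite mem_enum; exact: x_unif.
rewrite (@expectation_finite_cover _ _ _ P _ (enum (Omega n)) E _ v) ?enum_uniq //.
- rewrite big_seq (eq_bigr (fun e => (v e / #|Omega n|%:R)%:E)).
    by rewrite -big_seq big_enum /= sumEFin /= mulr_suml.
  by move=> e /PE ->.
- rewrite big_seq (eq_bigr _ PE) -big_seq big_enum /= sumEFin sumr_const.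
  by rewrite -[X in X%:E]mulr_natr mulVf // pnatr_eq0 -lt0n.
- by move=> e w _; exact: Xv.
Qed.

Lemma mem_Omega (n m : nat) (e : {ffun 'I_n -> bool}) : n = m.*2 ->
  (e \in Omega n) = ([set i | e i] \in layer [the finType of 'I_n] m).
Proof.
move=> nm; rewrite !inE.
have signE (c : bool) : (-1) ^+ c = 1 - 2 * (c : nat)%:R :> int by case: c.
under eq_bigr do rewrite signE.
rewrite sumrB -mulr_sumr sumr_const card_ord -natr_sum.
have -> : (\sum_(i < n) e i = #|[set i | e i]%SET|)%N.
  rewrite -sum1_card [RHS]big_mkcond; apply: eq_bigr => i _.
  by rewrite inE; case: (e i).
have -> : n%:R = 2 * m%:Z by rewrite natz nm -mul2n PoszM.
by rewrite -mulrBr mulf_eq0 /= subr_eq0 natz eqz_nat eq_sym.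
Qed.

Lemma sum_Omega (V : nmodType) (n m : nat) (h : {set 'I_n} -> V) : n = m.*2 ->
  \sum_(e in Omega n) h [set i | e i] = \sum_(A in layer 'I_n m) h A.
Proof.
move=> nm.
rewrite [RHS](reindex_onto (fun e : {ffun 'I_n -> bool} => [set i | e i]%SET)
  (fun A : {set 'I_n} => [ffun i => i \in A])) /=; last first.
  by move=> A _; apply/setP => i; rewrite inE ffunE.
apply: eq_bigl => e; rewrite -(mem_Omega _ nm).
suff -> : [ffun i => i \in [set i | e i]%SET] == e by rewrite andbT.
by apply/eqP/ffunP => i; rewrite ffunE inE.
Qed.

(** * The sharp inequality *)

Theorem theorem3 (R : realType) (n : nat) (n_even : ~~ odd n)
    (n_ge4 : (4 <= n)%N) (d : measure_display) (T : measurableType d)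
    (P : probability T R) (x : 'I_n -> {RV P >-> R})
    (x_unif : uniform_on_Omega x) :
  (forall a : 'I_n -> R,
     c_ R n * Num.sqrt
       (fine ('E_P[(fun w : T => `|\sum_(i < n) a i * x i w| ^+ 2)]))
     <= fine ('E_P[(fun w : T => `|\sum_(i < n) a i * x i w|)])) /\
  (forall C : R,
     (forall a : 'I_n -> R,
        C * Num.sqrt
          (fine ('E_P[(fun w : T => `|\sum_(i < n) a i * x i w| ^+ 2)]))
        <= fine ('E_P[(fun w : T => `|\sum_(i < n) a i * x i w|)])) ->
     C <= c_ R n).
Proof.
pose m := n./2; have nm : n = m.*2 by rewrite /m; lia.
have Tm : #|'I_n| = m.*2 by rewrite card_ord.
have cardO : #|Omega n| = #|layer 'I_n m|.
  by have := sum_Omega (fun=> 1%N) nm; rewrite !sum1_card.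
have N_gt0 : (0 < #|layer 'I_n m|)%N.
  by rewrite card_draws card_ord bin_gt0; lia.
have NR_gt0 : 0 < #|layer 'I_n m|%:R :> R by rewrite ltr0n.
have E_layer p (a : 'I_n -> R) :
    fine ('E_P[(fun w : T => `|\sum_(i < n) a i * x i w| ^+ p)])
      = (\sum_(A in layer 'I_n m) `|sign_sum a A| ^+ p) / #|layer 'I_n m|%:R.
  rewrite -cardO -(sum_Omega (fun A => `|sign_sum a A| ^+ p) nm).
  apply: (expectation_uniform_on_Omega x_unif) => [||w|e w xe].
  - by rewrite cardO.
  - apply: measurable_funX; apply: measurableT_comp => //.
    by apply: measurable_sum => i; apply: measurable_funM.
  - exact: exprn_ge0.
  - by congr (`|_| ^+ _); apply: eq_bigr => i _; rewrite xe inE.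
have E_layer1 (a : 'I_n -> R) :
    fine ('E_P[(fun w : T => `|\sum_(i < n) a i * x i w|)])
      = (\sum_(A in layer 'I_n m) `|sign_sum a A|) / #|layer 'I_n m|%:R.
  exact: (E_layer 1%N a).
have nR_ge4 : 4 <= n%:R :> R by rewrite ler_nat.
have c_arg_ge0 : 0 <= (n%:R - 2) / (2 * (n%:R - 1)) :> R.
  by apply: divr_ge0; lra.
split=> [a|C C_bound].
  rewrite E_layer E_layer1 /c_ -sqrtrM //.
  have m_ge2 : (2 <= m)%N by rewrite /m; lia.
  have := khinchin_layer a m_ge2 Tm; rewrite card_ord.
  set s := (X in _ <= _ * X ^+ 2 -> _); set q := \sum_(A in _) _.
  set N : R := #|_|%:R => Nqs.
  have s_ge0 : 0 <= s by apply: sumr_ge0.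
  have sN_ge0 : 0 <= s / N by apply: divr_ge0.
  rewrite -(ger0_norm sN_ge0) -sqrtr_sqr ler_wsqrtr //.
  have n1_gt0 : 0 < 2 * (n%:R - 1) :> R by lra.
  rewrite mulrAC ler_pdivrMr // mulrA ler_pdivrMr //.
  have -> : (s / N) ^+ 2 * (2 * (n%:R - 1)) * N = 2 * (n%:R - 1) * s ^+ 2 / N.
    by field; rewrite lt0r_neq0.
  by rewrite ler_pdivlMr //; lra.
pose i0 : 'I_n := Ordinal (leq_trans (isT : (0 < 4)%N) n_ge4).
pose i1 : 'I_n := Ordinal (leq_trans (isT : (1 < 4)%N) n_ge4).
have i01 : i0 != i1 by [].
(* For a = e_0 + e_1 the hypothesis on C reads C sqrt (2 t) <= t with t = E|S|. *)
have := C_bound (fun k => (k == i0)%:R + (k == i1)%:R).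
rewrite E_layer E_layer1.
under eq_bigr do rewrite sign_sum_pair sqr_norm_add_sign.
under [X in _ <= X / _]eq_bigr do rewrite sign_sum_pair.
rewrite -mulr_sumr -mulrA.
set t := (X in 2 * X).
have tE : t = (n%:R - 2) / (n%:R - 1).
  rewrite /t; under eq_bigr do rewrite norm_add_sign.
  rewrite big_split /= sumr_const.
  have := sign_cov_layer R Tm i01; rewrite card_ord => cov.
  set N : R := #|_|%:R in cov *.
  have n1_neq0 : n%:R - 1 != 0 :> R by apply: lt0r_neq0; lra.
  have -> : \sum_(A in layer 'I_n m) (-1) ^+ (i0 \in A) * (-1) ^+ (i1 \in A)
      = - N / (n%:R - 1) :> R.
    by rewrite -cov mulrC mulKf.
  by field; rewrite n1_neq0 lt0r_neq0.
have t_gt0 : 0 < t by rewrite tE; apply: divr_gt0; lra.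
have -> : c_ R n = Num.sqrt (t / 2).
  rewrite /c_ tE; congr Num.sqrt; field.
  by rewrite lt0r_neq0 //; lra.
have t_split : t = Num.sqrt (t / 2) * Num.sqrt (2 * t).
  rewrite -sqrtrM; last by lra.
  have -> : t / 2 * (2 * t) = t ^+ 2 by field.
  by rewrite sqrtr_sqr gtr0_norm.
by rewrite [X in _ <= X -> _]t_split ler_pM2r // sqrtr_gt0; lra.
Qed.
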